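(* Let $\Gamma$ be a finite connected graph and $k$ the base field. The toric variety $X_\Gamma$ does not contain torus factors and it has dimension $$\dim X_\Gamma=\dim\sigma_\Gamma^\vee=\operatorname{rank}\mathbb H_1(\Gamma,\mathbb Z)=b_1(\Gamma)+|E(\Gamma)|.$$
   Context: A graph $\Gamma$ consists of a set $V(\Gamma)$ of vertices, a set $\vec E(\Gamma)$ of oriented edges, a fixed-point-free involution $\iota$ of $\vec E(\Gamma)$, and maps $s,t:\vec E(\Gamma)\to V(\Gamma)$ with $s(\vec e)=t(\iota(\vec e))$ (loops and parallel edges are allowed). $E(\Gamma)=\vec E(\Gamma)/\iota$ is the set of unoriented edges, and for $\Gamma$ connected $b_1(\Gamma)=|E(\Gamma)|-|V(\Gamma)|+1$. The oriented homology $\mathbb H_1(\Gamma,\mathbb Z)$ is the kernel of $\mathbb D:\mathbb C_1(\Gamma,\mathbb Z)\to\mathbb C_0(\Gamma,\mathbb Z)$, $\vec e\mapsto t(\vec e)-s(\vec e)$, where $\mathbb C_1(\Gamma,\mathbb Z)$, $\mathbb C_0(\Gamma,\mathbb Z)$ are the free $\mathbb Z$-modules on $\vec E(\Gamma)$, $V(\Gamma)$. Let $(\cdot,\cdot)$ be the scalar product on $\mathbb C_1(\Gamma,\mathbb R)$ for which $\vec E(\Gamma)$ is orthonormal, and let $\sigma_\Gamma=\{x\in\mathbb H_1(\Gamma,\mathbb Z)\otimes\mathbb R: (x,\vec e)\ge0\ \forall \vec e\in\vec E(\Gamma)\}$, with dual cone $\sigma_\Gamma^\vee\subset\mathbb H_1(\Gamma,\mathbb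 Z)^\vee\otimes\mathbb R$. The cographic toric variety is $X_\Gamma=\operatorname{Spec}k[\sigma_\Gamma\cap\mathbb H_1(\Gamma,\mathbb Z)]$, the affine toric variety of the cone $\sigma_\Gamma^\vee$ in the lattice $\mathbb H_1(\Gamma,\mathbb Z)^\vee$. A toric variety has no torus factors if it is not equivariantly isomorphic to a product of a positive-dimensional torus with a toric variety of smaller dimension. *)

(* Defs.v *)
From HB Require Import structures.
From mathcomp Require Import all_boot all_order all_algebra.
From mathcomp Require Import finmap reals.
From mathcomp.multinomials Require monalg.

Set Implicit Arguments.
Unset Strict Implicit.
Unset Printing Implicit Defensive.

Import Order.TTheory GRing.Theory Num.Theory.
Import monalg.
Local Open Scope ring_scope.

(** * Monoid algebras *)

(* R[M] for an additive commutative monoid M: finitely supported functions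
   M -> R with the convolution product.  The monoids of [monalg] have no
   nontrivial units, which excludes lattices, so that only the module structure
   of {malg R[M]} is reused.  <<c *g m>> is the monomial c X^m. *)
Definition monoid_alg (R : comNzRingType) (M : nmodType) := {malg R[M]}.

Section MonoidAlg.
Variables (R : comNzRingType) (M : nmodType).
Local Notation A := (monoid_alg R M).
Implicit Types (f g h : A).

HB.instance Definition _ := GRing.Lmodule.copy A {malg R[M]}.

Definition madd_one : A := << 1 *g 0 >>.

Definition madd_mul f g : A :=
  \sum_(a <- msupp f) \sum_(b <- msupp g) << f@_a * g@_b *g a + b >>.

Lemma madd_mulw (d e : {fset M}) f g :
  (msupp f `<=` d)%fset -> (msupp g `<=` e)%fset ->
  madd_mul f g = \sum_(a <- d) \sum_(b <- e) << f@_a * g@_b *g a + b >>.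
Proof.
move=> sd se; rewrite /madd_mul -(big_fset_incl _ sd) /=; last first.
  move=> a _ /mcoeff_outdom ->.
  by rewrite big1 // => b _; rewrite mul0r monalgU0.
apply: eq_bigr => a _.
rewrite -(big_fset_incl _ se) //= => b _ /mcoeff_outdom ->.
by rewrite mulr0 monalgU0.
Qed.

Fact madd_mulC : commutative madd_mul.
Proof.
move=> f g; rewrite /madd_mul exchange_big /=.
by apply: eq_bigr => b _; apply: eq_bigr => a _; rewrite mulrC addrC.
Qed.

Fact madd_mulDl : left_distributive madd_mul +%R.
Proof.
move=> f g h; set d := (msupp f `|` msupp g)%fset.
rewrite (@madd_mulw d (msupp h) (f + g)) ?msuppD_le ?fsubset_refl //.
rewrite (@madd_mulw d (msupp h) f) ?fsubsetUl ?fsubset_refl //.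
rewrite (@madd_mulw d (msupp h) g) ?fsubsetUr ?fsubset_refl //.
rewrite -big_split /=; apply: eq_bigr => a _.
rewrite -big_split /=; apply: eq_bigr => b _.
by rewrite mcoeffD mulrDl monalgUD.
Qed.

Lemma madd_mulUU a b (x y : R) :
  madd_mul << x *g a >> << y *g b >> = << x * y *g a + b >>.
Proof.
rewrite (@madd_mulw [fset a]%fset [fset b]%fset) ?msuppU_le //.
by rewrite !big_seq_fset1 !mcoeffUU.
Qed.

Lemma madd_ind (P : A -> Prop) :
  P 0 -> (forall f g, P f -> P g -> P (f + g)) ->
  (forall a x, P << x *g a >>) -> forall f, P f.
Proof. by move=> P0 PD PU f; rewrite (monalgE f); apply: big_ind. Qed.

Lemma madd_mul0 g : madd_mul 0 g = 0.
Proof. by rewrite /madd_mul msupp0 big_seq_fset0. Qed.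

Lemma madd_mul0r g : madd_mul g 0 = 0.
Proof. by rewrite madd_mulC madd_mul0. Qed.

Lemma madd_mulDr f g h : madd_mul h (f + g) = madd_mul h f + madd_mul h g.
Proof. by rewrite ![madd_mul h _]madd_mulC madd_mulDl. Qed.

Fact madd_mul1 : left_id madd_one madd_mul.
Proof.
elim/madd_ind=> [|f g IHf IHg|a x]; first exact: madd_mul0r.
  by rewrite madd_mulDr IHf IHg.
by rewrite madd_mulUU mul1r add0r.
Qed.

Fact madd_mulA : associative madd_mul.
Proof.
move=> f g h; elim/madd_ind: f => [|f f' IHf IHf'|a x].
- by rewrite !madd_mul0.
- by rewrite !madd_mulDl IHf IHf'.
elim/madd_ind: g => [|g g' IHg IHg'|b y].
- by rewrite madd_mul0 madd_mul0r madd_mul0.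
- by rewrite madd_mulDl !madd_mulDr madd_mulDl IHg IHg'.
elim/madd_ind: h => [|h h' IHh IHh'|c z]; first by rewrite !madd_mul0r.
  by rewrite !madd_mulDr IHh IHh'.
by rewrite !madd_mulUU mulrA addrA.
Qed.

Fact madd_one_neq0 : madd_one != 0.
Proof. by rewrite monalgU_eq0 oner_neq0. Qed.

HB.instance Definition _ := GRing.Zmodule_isComNzRing.Build A
  madd_mulA madd_mulC madd_mul1 madd_mulDl madd_one_neq0.

Fact madd_scaleAl (c : R) f g : c *: (f * g) = (c *: f) * g.
Proof.
have scaleU a x : c *: (<< x *g a >> : A) = << c * x *g a >>.
  by apply/malgP => b; rewrite mcoeffZ !mcoeffU mulrnAr.
elim/madd_ind: f => [|f f' IHf IHf'|a x]; first by rewrite mul0r scaler0 mul0r.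
  by rewrite !(mulrDl, scalerDr) IHf IHf'.
elim/madd_ind: g => [|g g' IHg IHg'|b y]; first by rewrite !mulr0 scaler0.
  by rewrite !(mulrDr, scalerDr) IHg IHg'.
by rewrite scaleU [LHS](congr1 _ (madd_mulUU a b x y)) scaleU mulrA -madd_mulUU.
Qed.

HB.instance Definition _ := GRing.Lmodule_isLalgebra.Build R A madd_scaleAl.
HB.instance Definition _ := GRing.Lalgebra_isComAlgebra.Build R A.

End MonoidAlg.

(** * Dimensions *)

(* There is a chain P 0 < P 1 < ... < P n of prime ideals
   ([idealr_closed] ideals are proper). *)
Definition prime_chain (A : comNzRingType) (n : nat) : Prop :=
  exists P : nat -> {pred A},
    (forall i, (i <= n)%N ->
       idealr_closed (P i) /\ prime_idealr_closed (P i)) /\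
    (forall i, (i < n)%N ->
       {subset P i <= P i.+1} /\ exists2 x, x \in P i.+1 & x \notin P i).

Definition krull_dim (A : comNzRingType) (d : nat) : Prop :=
  forall n, prime_chain A n <-> (n <= d)%N.

(* The linear span of C has dimension d. *)
Definition cone_dim (F : fieldType) (V : vectType F) (C : V -> Prop) (d : nat) :
    Prop :=
  exists U : {vspace V}, \dim U = d /\
    forall W : {vspace V}, (forall x, C x -> x \in W) <-> (U <= W)%VS.

(* M is a free Z-module of rank d. *)
Definition free_rank (M : zmodType) (d : nat) : Prop :=
  exists b : 'I_d -> M,
    bijective (fun c : {ffun 'I_d -> int} => \sum_i b i *~ c i).

(** * Affine toric varieties *)

(* An affine k-scheme X = Spec coord_alg with an action of the split torus
   T = Spec k[char_lattice].  An action T x X -> X is a coaction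
   coord_alg -> k[char_lattice] (x) coord_alg, written
   a |-> \sum_m X^m (x) coact m a.  The comodule laws are not part of the record:
   they follow from [affine_toric], and hold for [torus_prod] over such a Y and
   for [monoid_scheme]. *)
Record torus_scheme (k : fieldType) := TorusScheme {
  char_lattice : zmodType;
  coord_alg : comAlgType k;
  coact : char_lattice -> coord_alg -> coord_alg
}.

Section Toric.
Variable k : fieldType.
Implicit Types X Y : torus_scheme k.

(* The comorphism f : k[X] -> k[Y] of an isomorphism Y -> X that is
   equivariant along the isomorphism of tori given on characters by g. *)
Definition equivariantly_isomorphic X Y : Prop :=
  exists (f : {lrmorphism coord_alg X -> coord_alg Y})
         (g : {additive char_lattice X -> char_lattice Y}),
    [/\ bijective f, bijective g
      & forall m a, f (coact m a) = coact (g m) (f a)].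

Definition finitely_generated_algebra (A : comAlgType k) : Prop :=
  exists s : seq A, forall B : {pred A},
    GRing.subalg_closed B -> {subset s <= B} -> forall a, a \in B.

(* The morphism Spec B -> Spec A given by an injective j is an open immersion:
   Spec B is covered by the D(j a), a in s, and A_a -> B_(j a) is an isomorphism
   (its injectivity follows from that of j). *)
Definition open_immersion (A B : comNzRingType) (j : A -> B) : Prop :=
  exists s : seq A,
    (exists c : A -> B, \sum_(a <- s) c a * j a = 1) /\
    (forall a, a \in s -> forall x : B, exists N a', j a' = j a ^+ N * x).

(* X is an affine variety containing its torus T as a dense open subset, such
   that the action of T on X extends the action of T on itself by translation.
   Injectivity of j says that T is dense in X and that X is integral. *)
Definition affine_toric X : Prop :=
  [/\ exists n, free_rank (char_lattice X) n,
      finitely_generated_algebra (coord_alg X)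
    & exists j : {lrmorphism coord_alg X -> monoid_alg k (char_lattice X)},
        [/\ injective j, open_immersion j
          & forall m a, j (coact m a) = << (j a)@_m *g m >>]].

Section TorusProduct.
Variables (r : nat) (Y : torus_scheme k).

(* k[G_m^r x Y] = k[Z^r] (x) k[Y] = k[Y][Z^r], as a k-algebra *)
Definition torus_prod_alg := monoid_alg (coord_alg Y) 'rV[int]_r.

HB.instance Definition _ := GRing.ComNzRing.copy torus_prod_alg
  (monoid_alg (coord_alg Y) 'rV[int]_r).

Definition torus_prod_scale (c : k) (a : torus_prod_alg) : torus_prod_alg :=
  c%:A *: (a : monoid_alg (coord_alg Y) 'rV[int]_r).

Fact torus_prod_scaleA c d a :
  torus_prod_scale c (torus_prod_scale d a) = torus_prod_scale (c * d) a.
Proof. by rewrite /torus_prod_scale scalerA -scalerAl mul1r scalerA. Qed.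

Fact torus_prod_scale1 : left_id 1 torus_prod_scale.
Proof. by move=> a; rewrite /torus_prod_scale !scale1r. Qed.

Fact torus_prod_scaleDr : right_distributive torus_prod_scale +%R.
Proof. by move=> c a b; exact: scalerDr. Qed.

Fact torus_prod_scaleDl a : {morph torus_prod_scale^~ a : c d / c + d}.
Proof. by move=> c d; rewrite /torus_prod_scale !scalerDl. Qed.

HB.instance Definition _ := GRing.Zmodule_isLmodule.Build k torus_prod_alg
  torus_prod_scaleA torus_prod_scale1 torus_prod_scaleDr torus_prod_scaleDl.

Fact torus_prod_scaleAl (c : k) (a b : torus_prod_alg) :
  c *: (a * b) = (c *: a) * b.
Proof. exact: (@scalerAl _ (monoid_alg (coord_alg Y) 'rV[int]_r)). Qed.

HB.instance Definition _ :=
  GRing.Lmodule_isLalgebra.Build k torus_prod_alg torus_prod_scaleAl.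
HB.instance Definition _ := GRing.Lalgebra_isComAlgebra.Build k torus_prod_alg.

(* G_m^r x Y with the action of G_m^r x T_Y *)
Definition torus_prod : torus_scheme k :=
  @TorusScheme k ('rV[int]_r * char_lattice Y)%type torus_prod_alg
    (fun m a => << coact m.2 a@_m.1 *g m.1 >>).

End TorusProduct.

(* It suffices to let Y range over affine toric varieties: if the affine X is
   isomorphic to T' x Y, then Y = {1} x Y is closed in X, hence affine. *)
Definition has_torus_factor X : Prop :=
  exists (r : nat) (Y : torus_scheme k),
    [/\ (0 < r)%N, affine_toric Y,
        exists dY dX, [/\ krull_dim (coord_alg Y) dY, krull_dim (coord_alg X) dX
                        & (dY < dX)%N]
      & equivariantly_isomorphic X (torus_prod r Y)].

(* Spec k[S] for a monoid S mapping to a lattice M by phi: the torus Spec k[M]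
   acts on the monomial X^s through the character phi s. *)
Definition monoid_scheme (M : zmodType) (S : nmodType)
    (phi : {additive S -> M}) : torus_scheme k :=
  @TorusScheme k M (monoid_alg k S)
    (fun m a => \sum_(s <- msupp a | phi s == m) << a@_s *g s >>).

End Toric.

(** * Graphs *)

Record graph := Graph {
  vert : finType;
  oedge : finType;
  src : oedge -> vert;
  tgt : oedge -> vert;
  rev_edge : oedge -> oedge;
  rev_edgeK : involutive rev_edge;
  rev_edge_neq : forall e, rev_edge e != e;
  src_rev_edge : forall e, src e = tgt (rev_edge e)
}.

Section Graph.
Variable G : graph.

Definition adjacent : rel (vert G) :=
  [rel v w | [exists e, (src e == v) && (tgt e == w)]].

Definition connected_graph : Prop :=
  (0 < #|vert G|)%N /\ forall v w : vert G, connect adjacent v w.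

Definition edges : {set {set oedge G}} :=
  [set [set e; rev_edge e] | e : oedge G].

Definition betti1 : int := #|edges|%:Z - #|vert G|%:Z + 1.

(* Coefficientwise form of the linear extension of e |-> tgt e - src e *)
Definition boundary (A : zmodType) (x : {ffun oedge G -> A}) :
    {ffun vert G -> A} :=
  [ffun v => \sum_e (x e *+ (tgt e == v) - x e *+ (src e == v))].

Fact boundary_is_additive (A : zmodType) : zmod_morphism (@boundary A).
Proof.
move=> x y; apply/ffunP => v; rewrite !ffunE -sumrB; apply: eq_bigr => e _.
by rewrite !ffunE !mulrnBl !opprD addrACA.
Qed.

HB.instance Definition _ (A : zmodType) :=
  GRing.isZmodMorphism.Build _ _ (@boundary A) (@boundary_is_additive A).

Fact boundary_is_scalable (F : fieldType) : scalable (@boundary F^o).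
Proof.
move=> c x; apply/ffunP => v; rewrite !ffunE scaler_sumr.
by apply: eq_bigr => e _; rewrite !ffunE scalerBr -!scalerMnr.
Qed.

HB.instance Definition _ (F : fieldType) :=
  GRing.isScalable.Build _ _ _ _ (@boundary F^o) (@boundary_is_scalable F).

(* H_1(G, Z) *)
Definition cycles : {pred {ffun oedge G -> int}} := [pred x | boundary x == 0].

Fact cycles_zmod_closed : zmod_closed cycles.
Proof.
split=> [|x y]; first by rewrite inE raddf0.
by rewrite !inE => /eqP x0 /eqP y0; rewrite boundary_is_additive x0 y0 subrr.
Qed.

HB.instance Definition _ :=
  GRing.isZmodClosed.Build {ffun oedge G -> int} cycles cycles_zmod_closed.

Definition H1 : Type := {x : {ffun oedge G -> int} | x \in cycles}.

HB.instance Definition _ := SubChoice.on H1.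
HB.instance Definition _ := [SubChoice_isSubZmodule of H1 by <:].

Variable R : realType.
Local Notation C1 := {ffun oedge G -> R^o}.

(* H_1(G, Z) (x) R = H_1(G, R), as a subspace of C_1(G, R) *)
Definition H1R : {vspace C1} := lker (linfun (@boundary R^o)).

Definition dotprod (x y : C1) : R := \sum_e x e * y e.

Definition basis_edge (e : oedge G) : C1 := [ffun e' => (e' == e)%:R].

Definition sigma : {pred C1} :=
  [pred x | (x \in H1R) && [forall e, 0 <= dotprod x (basis_edge e)]].

(* The dual cone, in H_1(G, Z)^dual (x) R = Hom(H_1(G, R), R) *)
Definition sigma_dual (l : 'Hom(subvs_of H1R, R^o)) : Prop :=
  forall x : subvs_of H1R, vsval x \in sigma -> (0 : R) <= l x.

Definition chain_to_real (x : {ffun oedge G -> int}) : C1 :=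
  [ffun e => (x e)%:~R].

(* The monoid sigma :&: H_1(G, Z) *)
Definition lattice_points : {pred H1} :=
  [pred x | chain_to_real (val x) \in sigma].

Lemma dot_basis_edge (x : C1) e : dotprod x (basis_edge e) = x e.
Proof.
rewrite /dotprod (bigD1 e) //= ffunE eqxx mulr1 big1 ?addr0 // => i /negPf ie.
by rewrite ffunE ie mulr0.
Qed.

Fact chain_to_real_is_additive : zmod_morphism chain_to_real.
Proof. by move=> x y; apply/ffunP => e; rewrite !ffunE rmorphB. Qed.

HB.instance Definition _ :=
  GRing.isZmodMorphism.Build _ _ chain_to_real chain_to_real_is_additive.

Fact lattice_points_addr_closed : Algebra.nmod_closed lattice_points.
Proof.
split=> [|x y]; rewrite !inE.
  rewrite !raddf0 ?mem0v /=; apply/forallP => e.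
  by rewrite dot_basis_edge ffunE.
move=> /andP[x1 /forallP x2] /andP[y1 /forallP y2].
rewrite !raddfD memvD //=; apply/forallP => e.
rewrite dot_basis_edge ffunE addr_ge0 //.
  by move: (x2 e); rewrite dot_basis_edge.
by move: (y2 e); rewrite dot_basis_edge.
Qed.

HB.instance Definition _ := GRing.isAddClosed.Build H1 lattice_points
  lattice_points_addr_closed.

Definition cone_monoid : Type := {x : H1 | x \in lattice_points}.

HB.instance Definition _ := SubChoice.on cone_monoid.
HB.instance Definition _ := GRing.SubChoice_isSubNmodule.Build H1
  (fun x => x \in lattice_points) cone_monoid lattice_points_addr_closed.

Definition cographic_toric (k : fieldType) : torus_scheme k :=
  monoid_scheme k (val : {additive cone_monoid -> H1}).

End Graph.

(* Main.v *)
From HB Require Import structures.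
Require Import Defs.
From mathcomp Require Import all_boot all_order all_algebra finmap reals.
From mathcomp Require Import zify.
From mathcomp.multinomials Require monalg.

Set Implicit Arguments.
Unset Strict Implicit.
Unset Printing Implicit Defensive.

Import Order.TTheory GRing.Theory Num.Theory.
Import monalg.
Local Open Scope ring_scope.

(** All four numbers are computed from one set of coordinates on the oriented
    homology.  Root a spanning tree of the graph at r, each edge of it pointing
    away from r; it uses one oriented edge for each vertex other than r.  The
    opposite orientations of tree edges count as non-tree edges, since oriented
    chains do not identify an edge with minus its reverse.  Every non-tree edge
    closes up through the tree to a fundamental cycle, and a cycle is the
    combination of the fundamental cycles whose coefficients are its own
    values on the non-tree edges ([cycle_decomposition]).  This holds with
    coefficients in any abelian group, so that the number of non-tree edges,
    which is 2|E| - |V| + 1, is both the rank of the integral homology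
    ([free_rank_H1]) and the dimension of the real one ([dim_H1R]).

    The dual cone contains the functionals reading the value of a cycle on an
    edge, which span the dual space by the same decomposition; hence it is full
    dimensional ([cone_dim_sigma_dual]).

    The dimension of k[S], for S = sigma :&: H_1(Z), is an instance of
    [krull_dim_monoid_alg]: if S is a submonoid of Z^d that generates Z^d as a
    group, then k[S] has Krull dimension d.  A chain of length d is obtained by
    forgetting the coordinates of Z^d one after the other: the kernels of the
    resulting maps k[S] -> k[Z^d] are prime because k[Z^d] is a domain (leading
    terms for the lexicographic order), and they grow strictly because S
    generates.  Conversely, a chain of length n yields n elements whose
    monomials with exponents less than N are linearly independent
    ([chain_growth]).  These N^n elements are supported in a box with O(N)^d
    points, so n <= d.  The monoid sigma :&: H_1(Z) generates H_1(Z) because the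
    sum of all oriented edges is a cycle, and adding a large multiple of it
    moves any given cycle into sigma.

    A torus factor would provide a nonconstant invertible element of k[S] that
    is homogeneous, hence a multiple of a monomial X^s with s <> 0, whose
    inverse has a term X^t with s + t = 0.  No such s exists, as elements of
    sigma have nonnegative coordinates ([pointed_no_torus_factor],
    [cone_monoid_pointed]). *)

(** * Monoid algebras of lattices *)

Definition monomial (k : fieldType) (M : nmodType) (c : k) (a : M) :
  monoid_alg k M := << c *g a >>.

Section MonoidAlgebra.
Variables (k : fieldType) (M : nmodType).
Implicit Types f g : monoid_alg k M.

Lemma monomialM (a b : M) (x y : k) :
  monomial x a * monomial y b = monomial (x * y) (a + b).
Proof. exact: madd_mulUU. Qed.

Lemma mcoeff_monomial (c : k) (a b : M) : (monomial c a)@_b = c *+ (a == b).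
Proof. exact: mcoeffU. Qed.

Lemma mcoeff_sum (I : Type) (r : seq I) (P : pred I)
    (F : I -> monoid_alg k M) m :
  (\sum_(i <- r | P i) F i)@_m = \sum_(i <- r | P i) (F i)@_m.
Proof. exact: (raddf_sum (mcoeff m)). Qed.

Lemma mcoeffM f g m :
  (f * g)@_m =
  \sum_(a <- msupp f) \sum_(b <- msupp g) (f@_a * g@_b) *+ (a + b == m).
Proof.
rewrite [f * g]/(madd_mul f g) mcoeff_sum; apply: eq_bigr => a _.
by rewrite mcoeff_sum; apply: eq_bigr => b _; rewrite mcoeffU.
Qed.

Lemma msuppM_sum f g m : m \in msupp (f * g) ->
  exists a b, [/\ a \in msupp f, b \in msupp g & m = a + b].
Proof.
rewrite -mcoeff_neq0 mcoeffM.
case: (boolP (has (fun a => has (fun b => a + b == m) (msupp g)) (msupp f))).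
  by case/hasP=> a fa /hasP[b gb /eqP <-] _; exists a, b.
move=> /hasPn no; rewrite big_seq big1 ?eqxx // => a /no /hasPn noa.
by rewrite big_seq big1 // => b /noa /negPf ->.
Qed.

End MonoidAlgebra.

(** A total order on M compatible with addition is given by its positive
    elements. *)
Section Domain.
Variables (k : fieldType) (M : zmodType) (pos : pred M).
Hypothesis posD : forall x y, pos x -> pos y -> pos (x + y).
Hypothesis pos0 : ~~ pos 0.
Hypothesis posV : forall x, x != 0 -> pos x || pos (- x).

Lemma pos_max (s : seq M) : s != [::] ->
  exists2 m, m \in s & forall x, x \in s -> (x == m) || pos (m - x).
Proof.
elim: s => // a [|b s] IH _.
  by exists a; rewrite ?mem_seq1 // => x; rewrite mem_seq1 => ->.
have [//|m ms mmax] := IH; have [am|nam] := eqVneq a m.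
  exists m; first by rewrite in_cons ms orbT.
  by move=> x; rewrite in_cons => /orP[/eqP->|/mmax //]; rewrite am eqxx.
have /orP[pam|pma] : pos (a - m) || pos (- (a - m)).
- by apply: posV; rewrite subr_eq0.
- exists a; first exact: mem_head.
  move=> x; rewrite in_cons => /orP[->//|/mmax /orP[/eqP->|pmx]].
    by rewrite pam orbT.
  by rewrite -[a - x](subrKA m) posD ?orbT.
- exists m; first by rewrite in_cons ms orbT.
  move=> x; rewrite in_cons => /orP[/eqP->|/mmax //].
  by rewrite -opprB pma orbT.
Qed.

(** The largest exponents a of f and b of g give a + b in a unique way, so the
    coefficient of the product there is the product of leading coefficients. *)
Lemma orderable_monoid_alg_domain (f g : monoid_alg k M) :
  f * g = 0 -> f = 0 \/ g = 0.
Proof.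
move=> fg0; have [->|f0] := eqVneq f 0; first by left.
have [->|g0] := eqVneq g 0; first by right.
have supp_neq0 (h : monoid_alg k M) : h != 0 -> (msupp h : seq M) != [::].
  apply: contraNneq => h0; apply/eqP/malgP => x; rewrite mcoeff0.
  by rewrite mcoeff_outdom // -[_ \in _]/(x \in (msupp h : seq M)) h0.
have [a fa amax] := pos_max (supp_neq0 _ f0).
have [b gb bmax] := pos_max (supp_neq0 _ g0).
have uniq_sum c e : c \in msupp f -> e \in msupp g -> (c + e == a + b) ->
    c = a /\ e = b.
  move=> fc ge; rewrite eq_sym -subr_eq0 opprD addrACA => /eqP s0.
  have /orP[/eqP ca|pac] := amax c fc.
    by move: s0; rewrite ca subrr add0r => /subr0_eq <-.
  have /orP[/eqP eb|pbe] := bmax e ge.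
    by move: s0; rewrite eb subrr addr0 => /subr0_eq <-.
  by case/negP: pos0; rewrite -s0 posD.
have : (f * g)@_(a + b) = f@_a * g@_b.
  rewrite mcoeffM (big_fsetD1 a) //= (big_fsetD1 b) //= eqxx mulr1n.
  rewrite !big_seq !big1 ?addr0 // => [c|c].
    rewrite in_fsetD1 => /andP[ca fc]; rewrite big_seq big1 // => e ge.
    case: (boolP (_ == _)) => // /(uniq_sum _ _ fc ge) [E].
    by rewrite E eqxx in ca.
  rewrite in_fsetD1 => /andP[cb gc].
  case: (boolP (_ == _)) => // /(uniq_sum _ _ fa gc) [_ E].
  by rewrite E eqxx in cb.
rewrite fg0 mcoeff0 => /esym/eqP.
by rewrite mulf_eq0 !mcoeff_eq0 fa gb.
Qed.
End Domain.

Section Lex.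
Variable d : nat.
Local Notation Zd := {ffun 'I_d -> int}.

Definition lexpos (x : Zd) : bool :=
  [exists i : 'I_d, (0 < x i) && [forall j : 'I_d, (j < i)%N ==> (x j == 0)]].

Lemma lexposP (x : Zd) :
  reflect (exists2 i : 'I_d, 0 < x i & forall j : 'I_d, (j < i)%N -> x j = 0)
    (lexpos x).
Proof.
apply: (iffP existsP) => -[i].
  case/andP=> xi /forallP x0; exists i => // j ji.
  by apply/eqP; exact: implyP (x0 j) ji.
move=> xi x0; exists i; rewrite xi; apply/forallP=> j.
by apply/implyP=> /x0/eqP.
Qed.

Lemma lexposD x y : lexpos x -> lexpos y -> lexpos (x + y).
Proof.
move=> /lexposP[i xi x0] /lexposP[j yj y0]; apply/lexposP.
have [ij|ji|ij] := ltngtP i j.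
- exists i => [|l li]; first by rewrite ffunE y0 // addr0.
  by rewrite ffunE x0 // y0 // (ltn_trans li).
- exists j => [|l lj]; first by rewrite ffunE x0 // add0r.
  by rewrite ffunE y0 // x0 // (ltn_trans lj).
- exists i => [|l li]; first by rewrite ffunE addr_gt0 // (val_inj ij).
  by rewrite ffunE x0 // y0 // -ij.
Qed.

Lemma lexpos0 : ~~ lexpos 0.
Proof. by apply/lexposP=> -[i]; rewrite ffunE ltxx. Qed.

Lemma lexposV x : x != 0 -> lexpos x || lexpos (- x).
Proof.
move=> x0; have [i xi] : exists i, x i != 0.
  apply/existsP; apply: contraNT x0; rewrite negb_exists => /forallP x0.
  by apply/eqP/ffunP=> i; rewrite ffunE; apply/eqP; have := x0 i; rewrite negbK.
case: (@arg_minnP _ i (fun i => x i != 0) val xi) => j xj jmin.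
have low (l : 'I_d) : (l < j)%N -> x l = 0.
  by move=> lj; apply/eqP; apply: contraTT lj => /jmin; rewrite -leqNgt.
have /orP[xj0|xj0] : (0 < x j) || (x j < 0) by rewrite orbC -neq_lt.
  by apply/orP; left; apply/lexposP; exists j.
apply/orP; right; apply/lexposP; exists j; first by rewrite ffunE oppr_gt0.
by move=> l /low xl; rewrite ffunE xl oppr0.
Qed.

Lemma lattice_alg_domain (k : fieldType) (f g : monoid_alg k Zd) :
  f * g = 0 -> f = 0 \/ g = 0.
Proof. exact: orderable_monoid_alg_domain lexposD lexpos0 lexposV f g. Qed.
End Lex.

Section Push.
Variables (k : fieldType) (M N : nmodType) (h : M -> N).
Implicit Types f g : monoid_alg k M.

(** The linear extension of h, a morphism of algebras if h is additive. *)
Definition push f : monoid_alg k N := \sum_(a <- msupp f) monomial f@_a (h a).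

Lemma pushEw (E : {fset M}) f : (msupp f `<=` E)%fset ->
  push f = \sum_(a <- E) monomial f@_a (h a).
Proof.
move=> sE; rewrite /push (big_fset_incl _ sE) // => a _ /mcoeff_outdom ->.
exact: monalgU0.
Qed.

Lemma push0 : push 0 = 0.
Proof. by rewrite /push msupp0 big_seq_fset0. Qed.

Lemma pushD f g : push (f + g) = push f + push g.
Proof.
rewrite (pushEw (msuppD_le f g)) (pushEw (fsubsetUl _ (msupp g))).
rewrite (pushEw (fsubsetUr (msupp f) _)) -big_split /=; apply: eq_bigr => a _.
by rewrite mcoeffD; exact: monalgUD.
Qed.

Lemma push_monomial c a : push (monomial c a) = monomial c (h a).
Proof. by rewrite (pushEw msuppU_le) big_seq_fset1 mcoeffUU. Qed.

Hypothesis hD : {morph h : a b / a + b}.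

Lemma pushM f g : push (f * g) = push f * push g.
Proof.
elim/madd_ind: f => [|f f' IH IH'|a x]; first by rewrite mul0r push0 mul0r.
  by rewrite mulrDl !pushD IH IH' mulrDl.
elim/madd_ind: g => [|g g' IH IH'|b y]; first by rewrite mulr0 push0 mulr0.
  by rewrite mulrDr !pushD IH IH' mulrDr.
rewrite -/(monomial x a) -/(monomial y b) monomialM !push_monomial monomialM.
by rewrite hD.
Qed.

End Push.

Lemma eq_push (k : fieldType) (M N : nmodType) (h h' : M -> N) :
  h =1 h' -> @push k M N h =1 push h'.
Proof. by move=> hh' f; apply: eq_bigr => a _; rewrite hh'. Qed.

Lemma push_comp (k : fieldType) (M N P : nmodType) (h : M -> N) (h' : N -> P)
    (f : monoid_alg k M) :
  push (h' \o h) f = push h' (push h f).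
Proof.
elim/madd_ind: f => [|f f' IH IH'|a x]; first by rewrite !push0.
  by rewrite !pushD IH IH'.
by rewrite !push_monomial.
Qed.

(** * Krull dimension of monoid algebras *)

Section IndependenceModuloPrimes.
Variables (k : fieldType) (A : comAlgType k).
Implicit Types P Q : {pred A}.

Definition indep_mod (P : {pred A}) (I : finType) (v : I -> A) : Prop :=
  forall c : I -> k, \sum_i c i *: v i \in P -> forall i, c i = 0.

Lemma ideal_mul P x y : idealr_closed P -> y \in P -> x * y \in P.
Proof. by case=> P0 _ PM Py; rewrite -[x * y]addr0; apply: PM. Qed.

Lemma ideal_addKr P x y : idealr_closed P -> y \in P -> x + y \in P -> x \in P.
Proof. by case=> P0 _ PM Py Pxy; rewrite -[x](addrK y) addrC -mulN1r PM. Qed.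

(** This is what replaces transcendence degrees.  In a relation modulo P the
    terms without x form a relation modulo Q, since x is in Q, so they vanish;
    as P is prime and avoids x, the rest of the relation can be divided by x. *)
Lemma indep_mod_powers P Q (I : finType) (v : I -> A) (x : A) (N : nat) :
  idealr_closed P -> prime_idealr_closed P -> idealr_closed Q ->
  {subset P <= Q} -> x \in Q -> x \notin P ->
  indep_mod Q v -> indep_mod P (fun p : I * 'I_N => v p.1 * x ^+ p.2).
Proof.
move=> Pid Ppr Qid PQ Qx Px ind.
have main n (c : I -> 'I_n -> k) :
    \sum_(i < n) (\sum_j c j i *: v j) * x ^+ i \in P -> forall j i, c j i = 0.
  elim: n c => [|n IH] c; first by move=> _ j [].
  rewrite big_ord_recl mulr1.
  under [X in _ + X]eq_bigr => i _ do rewrite lift0 exprS mulrCA.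
  rewrite -mulr_sumr => Psum.
  have c0 j : c j ord0 = 0.
    apply: (ind (c^~ ord0)); apply: (ideal_addKr Qid _ (PQ _ Psum)).
    by rewrite mulrC; exact: ideal_mul.
  move: Psum; rewrite big1 => [|j _]; last by rewrite c0 scale0r.
  rewrite add0r => /Ppr/orP[/negPn|/(IH (fun j i => c j (lift ord0 i))) cS].
    by rewrite Px.
  by move=> j i; case: (unliftP ord0 i) => [i' ->|->].
move=> c Psum [j i]; apply: (main N (fun j i => c (j, i))) j i.
rewrite (_ : \sum_(i < N) _ = \sum_i c i *: (v i.1 * x ^+ i.2)) //.
under eq_bigr => i _ do rewrite mulr_suml.
rewrite exchange_big pair_big /=; apply: eq_bigr => -[j i] _ /=.
by rewrite scalerAl.
Qed.

End IndependenceModuloPrimes.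

Section KrullDim.
Variables (k : fieldType) (S : nmodType) (d : nat).
Local Notation Zd := {ffun 'I_d -> int}.
Variable phi : {additive S -> Zd}.
Hypothesis phi_inj : injective phi.
Local Notation A := (monoid_alg k S).
Implicit Types f g : A.

Definition bounded (m : nat) f : Prop :=
  forall s, s \in msupp f -> forall j, (`|phi s j| <= m)%N.

Lemma bounded_exists f : exists m, bounded m f.
Proof.
exists (\max_(s <- msupp f) \max_j `|phi s j|)%N => s fs j.
apply: leq_trans (leq_bigmax_seq _ fs isT).
exact: (leq_bigmax j).
Qed.

Lemma bounded1 : bounded 0 1.
Proof.
move=> s; rewrite -mcoeff_neq0 mcoeffU.
have [<- _ j|_] := eqVneq (0 : S) s; first by rewrite raddf0 ffunE.
by rewrite eqxx.
Qed.

Lemma boundedM m n f g : bounded m f -> bounded n g -> bounded (m + n) (f * g).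
Proof.
move=> fm gn s /msuppM_sum[a [b [fa gb ->]]] j; rewrite raddfD ffunE.
by move: (fm a fa j) (gn b gb j); move: (phi a j) (phi b j) => x y; lia.
Qed.

Lemma boundedX m f i : bounded m f -> bounded (i * m) (f ^+ i).
Proof.
move=> fm; elim: i => [|i IH]; first exact: bounded1.
by rewrite exprS mulSn; apply: boundedM.
Qed.

Lemma boundedW m n f : (m <= n)%N -> bounded m f -> bounded n f.
Proof. by move=> mn fm s fs j; apply: leq_trans (fm s fs j) mn. Qed.

(** Elements supported in a box of Z^d are determined by their coefficients in
    the box, which has (2 m + 1)^d points. *)
Lemma card_indep_bounded (P : {pred A}) (I : finType) (v : I -> A) m :
  0 \in P -> indep_mod P v -> (forall i, bounded m (v i)) ->
  (#|I| <= m.*2.+1 ^ d)%N.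
Proof.
move=> P0 ind vm.
pose box := {ffun 'I_d -> 'I_(m.*2.+1)}.
pose enc s : box := [ffun j => inord `|(phi s j + m%:Z)%R|%N].
have enc_inj s t : (forall j, (`|phi s j| <= m)%N) ->
    (forall j, (`|phi t j| <= m)%N) -> enc s = enc t -> s = t.
  move=> sm tm /ffunP est; apply/phi_inj/ffunP => j.
  have := congr1 val (est j); rewrite !ffunE /= !inordK; last 2 first.
  - by move: (tm j); move: (phi t j) => x; lia.
  - by move: (sm j); move: (phi s j) => x; lia.
  by move: (sm j) (tm j); move: (phi s j) (phi t j) => x y; lia.
(* The coefficients of the v i in the box, on whose points enc is injective. *)
pose W := \matrix_(i < #|I|, b < #|{: box}|)
  \sum_(s <- msupp (v (enum_val i)) | enc s == enum_val b) (v (enum_val i))@_s.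
suff /eqP <- : row_free W.
  by rewrite (leq_trans (rank_leq_col W)) // card_ffun !card_ord.
apply: inj_row_free => u uW.
suff u0 i : u 0 (enum_rank i) = 0.
  by apply/rowP=> i; rewrite mxE -[i]enum_valK u0.
apply: (ind (fun i => u 0 (enum_rank i))) i.
suff -> : \sum_i u 0 (enum_rank i) *: v i = 0 by [].
apply/malgP => s; rewrite mcoeff_sum mcoeff0.
case: (boolP [forall j, (`|phi s j| <= m)%N]) => [/forallP sm|sm]; last first.
  rewrite big1 // => i _; rewrite mcoeffZ mcoeff_outdom ?mulr0 //.
  by apply: contra sm => vis; apply/forallP; exact: vm vis.
have := congr1 (fun w : 'rV__ => w 0 (enum_rank (enc s))) uW.
rewrite !mxE (reindex enum_rank) /=; last first.
  by exists enum_val => i _; rewrite ?enum_rankK ?enum_valK.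
move=> {2}<-; apply: eq_bigr => i _.
rewrite mcoeffZ !mxE !enum_rankK; congr (_ * _).
rewrite big_seq_cond (eq_bigl (fun t => (t \in msupp (v i)) && (t == s))).
  rewrite -big_seq_cond; case: (boolP (s \in msupp (v i))) => vis.
    rewrite big_mkcond (big_fsetD1 s) //= eqxx big_seq big1 ?addr0 // => t.
    by rewrite in_fsetD1 => /andP[/negPf->].
  rewrite mcoeff_outdom // big_seq_cond big1 // => t /andP[vit /eqP ts].
  by rewrite -ts vit in vis.
move=> t /=; case: (boolP (t \in _)) => //= vit; apply/eqP/eqP => [|->//].
by apply: enc_inj => //; exact: vm vit.
Qed.

(** C does not depend on N: it is the sum of bounds for elements x_i of P i.+1
    outside P i, and v lists the monomials in the x_i with exponents less than
    N.  The induction drops the smallest prime, since independence propagates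
    from larger primes to smaller ones. *)
Lemma chain_growth n (P : nat -> {pred A}) :
  (forall i, (i <= n)%N -> idealr_closed (P i) /\ prime_idealr_closed (P i)) ->
  (forall i, (i < n)%N ->
     {subset P i <= P i.+1} /\ exists2 x, x \in P i.+1 & x \notin P i) ->
  exists C, forall N, exists (I : finType) (v : I -> A),
    [/\ #|I| = (N ^ n)%N, indep_mod (P 0%N) v
      & forall i, bounded (C * N) (v i)].
Proof.
elim: n P => [|n IH] P Pid Pinc.
  exists 0%N => N; exists unit, (fun _ => 1); split; first by rewrite card_unit.
    move=> c; rewrite (big_pred1 tt) => [Pc [] | []] //.
    have [P0id _] := Pid 0%N (leqnn _); have [_ P1 _] := P0id.
    apply/eqP; apply: contraNT P1 => c0.
    have -> : 1 = (c tt)^-1%:A * (c tt *: 1) :> A.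
      by rewrite -scalerAr mulr1 scalerA mulfV // scale1r.
    exact: ideal_mul.
  by move=> _; exact: bounded1.
have [C HC] := IH (fun i => P i.+1) (fun i => Pid i.+1) (fun i => Pinc i.+1).
have [P01 [x P1x P0x]] := Pinc 0%N isT.
have [B xB] := bounded_exists x.
exists (C + B)%N => N; have [I [v [cardI ind vb]]] := HC N.
exists (I * 'I_N)%type, (fun p : I * 'I_N => v p.1 * x ^+ p.2); split.
- by rewrite card_prod cardI card_ord expnSr.
- have [P0id P0pr] := Pid 0%N isT; have [P1id _] := Pid 1%N isT.
  exact: indep_mod_powers P0id P0pr P1id P01 P1x P0x ind.
- move=> [i e] /=; rewrite mulnDl; apply: boundedM => //.
  apply: boundedW (boundedX (i := e) xB).
  by rewrite mulnC leq_mul2l ltnW ?orbT.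
Qed.

Lemma exp_growth_le C n :
  (forall N, (N ^ n <= (C * N).*2.+1 ^ d)%N) -> (n <= d)%N.
Proof.
move=> grow; rewrite leqNgt; apply/negP => dn.
(* (2 C N + 1)^d <= K N^d for N > 0, which N^(d + 1) exceeds at N = K + 1. *)
pose K := (C.*2.+1 ^ d)%N; have := grow K.+1; apply/negP; rewrite -ltnNge.
apply: leq_trans (_ : (K.+1 ^ d.+1 <= _)%N); last by rewrite leq_pexp2l.
apply: leq_ltn_trans (_ : (K * K.+1 ^ d < _)%N); last first.
  by rewrite expnS ltn_pmul2r ?expn_gt0.
rewrite -expnMn; have [->|d0] := posnP d; first by rewrite !expn0.
by rewrite leq_exp2r //; lia.
Qed.

(** The successive projections Z^d -> Z^(d - i), with a common target so that
    the flag of ideals is defined uniformly in i. *)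
Definition forget_coords i (z : Zd) : Zd :=
  [ffun j : 'I_d => if (j < i)%N then 0 else z j].

Lemma forget_coordsD i : {morph forget_coords i : x y / x + y}.
Proof.
move=> x y; apply/ffunP=> j; rewrite !ffunE.
by case: ifP; rewrite ?addr0.
Qed.

Definition flag_ideal i : {pred A} :=
  [pred f | push (forget_coords i \o phi) f == 0].

Lemma flag_ideal_prime i :
  idealr_closed (flag_ideal i) /\ prime_idealr_closed (flag_ideal i).
Proof.
have hD : {morph forget_coords i \o phi : a b / a + b}.
  by move=> a b; rewrite /= raddfD forget_coordsD.
split; first split; rewrite ?inE ?push0 //.
- rewrite (push_monomial _ (1 : k) 0) /= raddf0.
  apply/negP=> /eqP.
  move/(congr1 (fun h : monoid_alg k Zd => h@_(forget_coords i 0))).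
  by rewrite mcoeff_monomial eqxx mcoeff0 => /eqP; rewrite oner_eq0.
- move=> a f g; rewrite !inE => /eqP f0 /eqP g0.
  by rewrite pushD pushM // f0 g0 mulr0 addr0.
- move=> f g; rewrite !inE pushM // => /eqP/lattice_alg_domain.
  by case=> ->; rewrite eqxx ?orbT.
Qed.

Lemma flag_idealS i : {subset flag_ideal i <= flag_ideal i.+1}.
Proof.
move=> f; rewrite !inE => /eqP f0.
have E : forget_coords i.+1 \o phi
      =1 forget_coords i.+1 \o (forget_coords i \o phi).
  move=> s; apply/ffunP=> j; rewrite !ffunE ltnS.
  by have [//|/ltnW ij] := leqP j i; rewrite (ltnNge j i) ij.
by rewrite (eq_push E) push_comp f0 push0.
Qed.

(** The i-th inclusion of the flag is strict because S contains two elements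
    that differ by the i-th unit vector. *)
Lemma krull_dim_monoid_alg :
  (forall z, exists s t, phi s = z + phi t) -> krull_dim A d.
Proof.
move=> gen n; split=> [[P [Pid Pinc]]|nd].
  have [C HC] := chain_growth Pid Pinc; apply: (@exp_growth_le C) => N.
  have [I [v [cardI ind vb]]] := HC N; rewrite -cardI.
  have [[P0 _ _] _] := Pid 0%N isT.
  exact: card_indep_bounded P0 ind vb.
exists flag_ideal; split=> [i _|i ni]; first exact: flag_ideal_prime.
split; first exact: flag_idealS.
have id : (i < d)%N := leq_trans ni nd.
pose e : Zd := [ffun j => (j == Ordinal id)%:R].
have [s [t st]] := gen e.
exists (monomial 1 s + monomial (-1) t).
  rewrite inE pushD !push_monomial /=.
  have -> : forget_coords i.+1 (phi s) = forget_coords i.+1 (phi t).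
    apply/ffunP=> j; rewrite st !ffunE; case: leqP => // ij.
    by rewrite -val_eqE /= gtn_eqF // add0r.
  apply/eqP/malgP=> m; rewrite mcoeffD !mcoeff_monomial mcoeff0.
  by rewrite -mulrnDl subrr mul0rn.
rewrite inE pushD !push_monomial /=; apply/eqP.
move/(congr1 (fun h : monoid_alg k Zd => h@_(forget_coords i (phi s)))).
rewrite mcoeffD !mcoeff_monomial mcoeff0 eqxx.
case: eqP => [/ffunP/(_ (Ordinal id))|_ /eqP].
  rewrite st !ffunE ltnn eqxx /= => /eqP.
  by rewrite -subr_eq0 opprD addrCA subrr.
by rewrite addr0 oner_eq0.
Qed.

End KrullDim.

(** * Fundamental cycles of a spanning tree *)

Section SpanningTree.
Variable G : graph.
Local Notation V := (vert G).
Local Notation E := (oedge G).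

(** Breadth-first search: h is the distance to r, and [pe v] is the last edge of
    a shortest path from r to v. *)
Lemma spanning_tree_exists : connected_graph G ->
  exists (r : V) (h : V -> nat) (pe : V -> option E), pe r = None /\
    forall v, v != r ->
      exists e, [/\ pe v = Some e, tgt e = v & (h (src e) < h v)%N].
Proof.
case=> /card_gt0P[r _] conn.
pose reach v n :=
  [exists p : n.-tuple V, path (@adjacent G) r p && (last r p == v)].
have reachP v : exists n, reach v n.
  case/connectP: (conn r v) => p pp ->; exists (size p).
  by apply/existsP; exists (in_tuple p); rewrite pp eqxx.
pose h v := ex_minn (reachP v).
have hr : h r = 0%N.
  rewrite /h; case: ex_minnP => n _ nmin; apply/eqP; rewrite -leqn0 nmin //.
  by apply/existsP; exists [tuple]; rewrite /= eqxx.
have step v : v != r -> exists e, (tgt e == v) && (h (src e) < h v)%N.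
  move=> vr; rewrite [h v]/h.
  case: ex_minnP => n /existsP[p /andP[pp /eqP lp]] _.
  move: (size_tuple p) pp lp; case/lastP: (val p) => [_ _ /= rv|s w].
    by rewrite rv eqxx in vr.
  rewrite size_rcons rcons_path last_rcons => <-.
  move=> /andP[ps /existsP[e]] /andP[se te] wv.
  exists e; rewrite (eqP te) wv eqxx /= ltnS (eqP se).
  rewrite /h; case: ex_minnP => m _; apply.
  by apply/existsP; exists (in_tuple s); rewrite ps eqxx.
exists r, h, (fun v => [pick e | (tgt e == v) && (h (src e) < h v)%N]).
split=> [|v vr]; first by case: pickP => // e; rewrite hr ltn0 andbF.
case: pickP => [e /andP[/eqP te he]|no]; first by exists e.
by have [e] := step v vr; rewrite no.
Qed.

Variables (r : V) (h : V -> nat) (pe : V -> option E).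
Hypothesis pe_root : pe r = None.
Hypothesis peP : forall v, v != r ->
  exists e, [/\ pe v = Some e, tgt e = v & (h (src e) < h v)%N].

Definition parent v := if pe v is Some e then src e else v.

Lemma tgt_pe v e : pe v = Some e -> tgt e = v.
Proof.
move=> pv; have [vr|/peP[e' []]] := eqVneq v r.
  by rewrite vr pe_root in pv.
by rewrite pv => -[->].
Qed.

Lemma iter_parent n v : (h v <= n)%N -> iter n parent v = r.
Proof.
have fix_root m : iter m parent r = r.
  by apply: iter_fix; rewrite /parent pe_root.
elim: n v => [|n IH] v hv; have [->//|/peP[e [pv _ he]]] := eqVneq v r.
  by move: he; have -> : h v = 0%N by lia.
by rewrite iterSr; apply: IH; rewrite /parent pv; lia.
Qed.

(** A common number of steps after which all vertices have reached the root. *)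
Definition height := (\max_v h v)%N.

(** The path from the root to v in the tree.  At the root [pe] is [None], so the
    superfluous steps contribute nothing. *)
Definition tree_path v : {ffun E -> int} :=
  [ffun e => \sum_(i < height) (pe (iter i parent v) == Some e)%:R].

Definition edge_chain e : {ffun E -> int} := [ffun e' => (e' == e)%:R].

Definition vertex_chain v : {ffun V -> int} := [ffun w => (w == v)%:R].

Lemma tree_path_step v e :
  pe v = Some e -> tree_path v = edge_chain e + tree_path (src e).
Proof.
move=> pv; apply/ffunP=> e'; rewrite !ffunE.
have -> : src e = parent v by rewrite /parent pv.
under [in RHS]eq_bigr => i _ do rewrite -iterSr.
have top : iter height parent v = r.
  by apply: iter_parent; exact: (leq_bigmax v).
(* The extra last step starts at the root, so it adds 0 while completing both
   sides to a sum over height.+1 steps from v. *)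
apply: (@addIr _ (pe (iter height parent v) == Some e')%:R).
rewrite -(big_ord_recr height (fun i => (pe (iter i parent v) == Some e')%:R)).
rewrite big_ord_recl /= top pe_root /= addr0 pv.
by congr (_ + _); rewrite (inj_eq Some_inj) eq_sym.
Qed.

Lemma tree_path_root : tree_path r = 0.
Proof.
apply/ffunP=> e; rewrite !ffunE big1 // => i _.
by rewrite iter_fix /parent pe_root.
Qed.

Lemma boundary_edge_chain e :
  boundary (edge_chain e) = vertex_chain (tgt e) - vertex_chain (src e).
Proof.
apply/ffunP=> v; rewrite !ffunE (bigD1 e) //= big1 => [|e' /negPf ne].
  by rewrite ffunE eqxx addr0 ![v == _]eq_sym.
by rewrite ffunE ne !mul0rn subrr.
Qed.

Lemma boundary_tree_path v :
  boundary (tree_path v) = vertex_chain v - vertex_chain r.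
Proof.
have [n] := ubnP (h v); elim: n v => // n IH v hv.
have [->|/peP[e [pv te he]]] := eqVneq v r.
  by rewrite tree_path_root raddf0 subrr.
rewrite (tree_path_step pv) raddfD /= boundary_edge_chain IH; last lia.
by rewrite te addrA subrK.
Qed.

Definition fundamental_cycle e :=
  edge_chain e + tree_path (src e) - tree_path (tgt e).

Lemma boundary_fundamental_cycle e : boundary (fundamental_cycle e) = 0.
Proof.
rewrite raddfB raddfD /= boundary_edge_chain !boundary_tree_path.
by rewrite subrKA subrr.
Qed.

Definition non_tree : {set E} := [set e | pe (tgt e) != Some e].

Lemma tree_path_non_tree v e : e \in non_tree -> tree_path v e = 0.
Proof.
rewrite inE => ne; rewrite ffunE big1 // => i _.
by case: eqP => // pie; rewrite (tgt_pe pie) pie eqxx in ne.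
Qed.

Lemma fundamental_cycle_non_tree e e' :
  e' \in non_tree -> fundamental_cycle e e' = (e' == e)%:R.
Proof.
move=> ne; have ffD (x y : {ffun E -> int}) : (x - y) e' = x e' - y e'.
  by rewrite !ffunE.
rewrite ffD tree_path_non_tree // subr0.
by rewrite ffunE tree_path_non_tree // addr0 ffunE.
Qed.

Lemma fundamental_cycle_tree e : e \notin non_tree -> fundamental_cycle e = 0.
Proof.
rewrite inE negbK => /eqP/tree_path_step pe_e.
by rewrite /fundamental_cycle pe_e subrr.
Qed.

(** When [fundamental_cycle] is summed over all edges with coefficients x, the
    tree paths add up to minus the sum over v of the boundary of x at v times
    the path to v, which vanishes.  Tree edges drop out, as their fundamental
    cycle is 0. *)
Lemma cycle_decomposition (B : zmodType) (x : {ffun E -> B}) :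
  boundary x = 0 ->
  forall e', x e' = \sum_(e in non_tree) x e *~ fundamental_cycle e e'.
Proof.
move=> x0 e'; rewrite big_mkcond /=.
have -> : \sum_e (if e \in non_tree then x e *~ fundamental_cycle e e' else 0)
    = \sum_e x e *~ fundamental_cycle e e'.
  apply: eq_bigr => e _; case: ifPn => // /fundamental_cycle_tree ->.
  by rewrite ffunE mulr0z.
have fundE e : fundamental_cycle e e'
    = (e' == e)%:R + (tree_path (src e) e' - tree_path (tgt e) e').
  rewrite /fundamental_cycle -addrA ffunE [X in X + _]ffunE.
  by congr (_ + _); rewrite ffunE; congr (_ + _); rewrite ffunE.
have pick_vertex (b : B) w :
    \sum_v (b *+ (w == v)) *~ tree_path v e' = b *~ tree_path w e'.
  rewrite (bigD1 w) //= eqxx big1 ?addr0 // => v /negPf wv.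
  by rewrite eq_sym wv mul0rz.
have sum0 :
    \sum_e (x e *~ tree_path (tgt e) e' - x e *~ tree_path (src e) e') = 0.
  transitivity (\sum_v boundary x v *~ tree_path v e').
    under [RHS]eq_bigr => v _ do rewrite ffunE mulrz_suml.
    rewrite exchange_big; apply: eq_bigr => e _ /=.
    under eq_bigr => v _ do rewrite mulrzBl.
    by rewrite sumrB !pick_vertex.
  by rewrite x0 big1 // => v _; rewrite ffunE mul0rz.
under eq_bigr => e _.
  rewrite fundE mulrzDr mulrzBr -opprB mulrz_nat.
  over.
rewrite sumrB sum0 subr0 (bigD1 e') //= eqxx big1 ?addr0 // => e /negPf ne.
by rewrite eq_sym ne.
Qed.

(** A tree edge is determined by its target, any vertex but the root. *)
Lemma card_non_tree : (#|non_tree| + #|V| = #|E| + 1)%N.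
Proof.
have -> : #|V| = #|~: non_tree|.+1.
  rewrite -[LHS]prednK; last by apply/card_gt0P; exists r.
  rewrite -(cardsC1 r) (_ : [set~ r] = [set tgt e | e in ~: non_tree]).
    rewrite card_in_imset // => e e'.
    rewrite !inE !negbK => /eqP pe1 /eqP pe2 te.
    by apply/Some_inj; rewrite -pe1 -pe2 te.
  apply/setP=> v; rewrite !inE; apply/idP/imsetP=> [/peP[e [pv te _]]|[e]].
    by exists e; rewrite // !inE te pv eqxx.
  rewrite !inE negbK => /eqP pe_e ->.
  by apply: contra_eq_neq pe_e => ->; rewrite pe_root.
by rewrite addnS cardsC addn1.
Qed.
End SpanningTree.

(** What the rest of the proof retains of a spanning tree: A is the set of
    non-tree edges and z e the fundamental cycle of e. *)
Definition cycle_basis (G : graph) (A : {set oedge G})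
    (z : oedge G -> {ffun oedge G -> int}) : Prop :=
  [/\ forall e, boundary (z e) = 0,
      {in A &, forall e e', z e e' = (e' == e)%:R}
    & forall (B : zmodType) (x : {ffun oedge G -> B}), boundary x = 0 ->
        forall e', x e' = \sum_(e in A) x e *~ z e e'].

Lemma cycle_basis_exists (G : graph) : connected_graph G ->
  exists (A : {set oedge G}) z,
    cycle_basis A z /\ (#|A| + #|vert G| = #|oedge G| + 1)%N.
Proof.
move=> /spanning_tree_exists[r [h [pe [pe_root peP]]]].
exists (non_tree pe), (fundamental_cycle h pe).
split; last exact: (card_non_tree pe_root peP).
split=> [e|e e' _ Ae'|B x x0 e'].
- exact: (boundary_fundamental_cycle pe_root peP).
- exact: (fundamental_cycle_non_tree (h := h) pe_root peP).
- exact: (cycle_decomposition pe_root peP).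
Qed.

Lemma card_oedge (G : graph) : #|oedge G| = (#|edges G| * 2)%N.
Proof.
pose f (e : oedge G) := [set e; rev_edge e].
rewrite -cardsT -sum1_card (partition_big_imset f) /=.
have -> : f @: [set: oedge G] = edges G.
  by apply/setP=> A; apply/imsetP/imsetP=> -[e _ ->]; exists e.
rewrite -sum_nat_const; apply: eq_bigr => _ /imsetP[e _ ->].
transitivity #|f e|; last by rewrite /f cards2 eq_sym rev_edge_neq.
rewrite sum1_card; apply: eq_card => e'; rewrite unfold_in /= inE /=.
apply/eqP/set2P=> [fe|[]->]; last 2 first.
- by [].
- by rewrite /f rev_edgeK setUC.
by apply/set2P; rewrite -fe set21.
Qed.

(** * Torus factors *)

(** A coordinate of the torus factor is a unit, homogeneous for the action of
    the whole torus.  It corresponds to a homogeneous unit U of k[S]; as S has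
    no nontrivial invertible element, the degree m of U can only be 0. *)
Lemma pointed_no_torus_factor (k : fieldType) (M : zmodType) (S : nmodType)
    (phi : {additive S -> M}) :
  (forall s t : S, s + t = 0 -> s = 0) ->
  ~ has_torus_factor (monoid_scheme k phi).
Proof.
move=> pointed [r [Y [r0 [_ _ [j [j_inj _ jcoact]]] _]]].
move=> [f [g [[finv finvK fK] [ginv ginvK gK] fcoact]]].
pose w : 'rV[int]_r := const_mx 1.
pose u : torus_prod_alg r Y := << 1 *g w >>.
pose u' : torus_prod_alg r Y := << 1 *g - w >>.
have uu' : u * u' = 1.
  by rewrite [u * u'](madd_mulUU w (- w)) mulr1 subrr.
have coact01 : coact (0 : char_lattice Y) 1 = 1.
  apply: j_inj; rewrite jcoact rmorph1.
  by rewrite mcoeffUU.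
pose m := ginv (w, 0); pose U := finv u.
have Uhom : coact (t := monoid_scheme k phi) m U = U.
  apply: (can_inj finvK); rewrite fcoact /m gK /U fK /= mcoeffUU.
  by rewrite coact01.
have UU' : U * finv u' = 1.
  apply: (can_inj finvK); rewrite rmorph1 -uu' rmorphM.
  by congr (_ * _); exact: fK.
have : 0 \in msupp (1 : monoid_alg k S).
  by rewrite -mcoeff_neq0 mcoeffUU oner_eq0.
rewrite -UU' => /msuppM_sum[s [t [sU _ /esym/pointed s0]]].
have m0 : m = 0.
  rewrite -[RHS](raddf0 phi) -s0; apply/eqP.
  move: sU; rewrite -mcoeff_neq0 -Uhom /= mcoeff_sum; apply: contraNT => ms.
  rewrite big1 // => s1 /eqP s1m; rewrite mcoeffU.
  by case: eqP => // s1s; rewrite -s1s s1m eqxx in ms.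
have : g m = 0 by rewrite m0 raddf0.
rewrite /m gK => -[/rowP/(_ (Ordinal r0))]; rewrite !mxE => /eqP.
by rewrite oner_eq0.
Qed.

(** * The monoid of lattice points *)

Section ConeMonoid.
Variables (G : graph) (R : realType).

Lemma boundary_chain_to_real (x : {ffun oedge G -> int}) v :
  boundary (chain_to_real R x) v = (boundary x v)%:~R.
Proof.
rewrite !ffunE rmorph_sum; apply: eq_bigr => e _.
by rewrite rmorphB !rmorphMn /= !ffunE.
Qed.

Lemma mem_H1R (x : {ffun oedge G -> R^o}) : (x \in H1R G R) = (boundary x == 0).
Proof. by rewrite memv_ker lfunE. Qed.

Lemma sigmaP (x : {ffun oedge G -> R^o}) :
  reflect (boundary x = 0 /\ forall e, 0 <= x e) (x \in @sigma G R).
Proof.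
rewrite inE mem_H1R; apply: (iffP andP) => [[/eqP x0 /forallP xge]|[x0 xge]].
  by split=> // e; rewrite -dot_basis_edge.
rewrite x0 eqxx; split=> //; apply/forallP=> e.
by rewrite dot_basis_edge.
Qed.

Lemma lattice_pointsP (x : H1 G) :
  reflect (forall e, 0 <= val x e) (x \in lattice_points R).
Proof.
rewrite inE; apply: (iffP (sigmaP _)) => [[_ xge] e|xge].
  by have := xge e; rewrite ffunE ler0z.
split=> [|e]; last by rewrite ffunE ler0z.
apply/ffunP=> v; rewrite boundary_chain_to_real.
by have /eqP -> := valP x; rewrite !ffunE.
Qed.

Lemma cone_monoid_pointed (s t : cone_monoid G R) : s + t = 0 -> s = 0.
Proof.
move=> /(congr1 val); rewrite raddfD raddf0 /= => st0.
apply/val_inj/val_inj/ffunP=> e; rewrite raddf0 /= ffunE.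
have /lattice_pointsP/(_ e) se := valP s.
have /lattice_pointsP/(_ e) te := valP t.
have : val (val s) e + val (val t) e = 0.
  by move/(congr1 val): st0 => /ffunP/(_ e); rewrite !ffunE.
by move/eqP; rewrite paddr_eq0 // => /andP[/eqP].
Qed.

(** Reversal of edges exchanges sources and targets. *)
Lemma boundary_const_chain (c : int) : boundary [ffun _ : oedge G => c] = 0.
Proof.
apply/ffunP=> v; rewrite !ffunE sumrB.
under eq_bigr => e _ do rewrite ffunE.
under [X in _ - X]eq_bigr => e _ do rewrite ffunE.
rewrite [X in _ - X](reindex_inj (inv_inj (@rev_edgeK G))) /=.
apply/eqP; rewrite subr_eq0; apply/eqP/eq_bigr => e _.
by rewrite src_rev_edge rev_edgeK.
Qed.

Definition H1_of (x : {ffun oedge G -> int}) (x0 : boundary x = 0) : H1 G :=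
  exist (fun y => y \in @cycles G) x (introT eqP x0).

(** Adding a large constant chain to x makes all its values nonnegative. *)
Lemma cone_monoid_generates (x : H1 G) :
  exists s t : cone_monoid G R, val s = x + val t.
Proof.
pose n : int := (\max_e `|val x e|)%N.
pose y := H1_of (boundary_const_chain n).
have yS : y \in lattice_points R by apply/lattice_pointsP=> e; rewrite /= ffunE.
have xyS : x + y \in lattice_points R.
  apply/lattice_pointsP=> e; rewrite raddfD /= !ffunE.
  have := leq_bigmax (F := fun e => `|val x e|%N) e; rewrite /n.
  by move: (val x e) (\max_e _)%N => a b; lia.
pose P := fun z : H1 G => z \in lattice_points R.
by exists (exist P (x + y) xyS), (exist P y yS).
Qed.
End ConeMonoid.

(** * Coordinates on the homology *)

Section CycleCoordinates.
Variables (G : graph) (A : {set oedge G}).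
Variable z : oedge G -> {ffun oedge G -> int}.
Hypothesis zA : cycle_basis A z.
Local Notation Zd := {ffun 'I_#|A| -> int}.

Definition coords (x : H1 G) : Zd := [ffun i => val x (enum_val i)].

Fact coords_is_additive : zmod_morphism coords.
Proof. by move=> x y; apply/ffunP=> i; rewrite ffunE raddfB /= !ffunE. Qed.

HB.instance Definition _ :=
  GRing.isZmodMorphism.Build _ _ coords coords_is_additive.

Lemma coords_inj : injective coords.
Proof.
have [_ _ decomp] := zA.
have cyc (x : H1 G) : boundary (val x) = 0 by case: x => x /= /eqP.
move=> x y /ffunP xy; apply/val_inj/ffunP=> e'.
rewrite (decomp _ _ (cyc x)) (decomp _ _ (cyc y)).
apply: eq_bigr => e Ae; congr (_ *~ _).
by have := xy (enum_rank_in Ae e); rewrite !ffunE enum_rankK_in.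
Qed.

Definition basis_cycle (i : 'I_#|A|) : H1 G :=
  H1_of (let: And3 z0 _ _ := zA in z0 (enum_val i)).

Lemma coords_sum (c : Zd) : coords (\sum_i basis_cycle i *~ c i) = c.
Proof.
have [_ zz _] := zA.
apply/ffunP=> j; rewrite raddf_sum sum_ffunE (bigD1 j) //= big1 => [|i ij].
  rewrite raddfMz /= ffunMzE ffunE /= zz ?enum_valP //.
  by rewrite eqxx addr0 mulrzz mul1r.
rewrite raddfMz /= ffunMzE ffunE /= zz ?enum_valP //.
by rewrite (inj_eq enum_val_inj) eq_sym (negPf ij) mul0rz.
Qed.

Lemma free_rank_H1 : free_rank (H1 G) #|A|.
Proof.
exists basis_cycle; exists coords; first exact: coords_sum.
by move=> x; apply: coords_inj; rewrite coords_sum.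
Qed.

Lemma krull_dim_cographic (k : fieldType) (R : realType) :
  krull_dim (coord_alg (cographic_toric G R k)) #|A|.
Proof.
pose phi : {additive cone_monoid G R -> Zd} := coords \o val.
apply: (@krull_dim_monoid_alg k _ _ phi) => [|c].
  exact: inj_comp coords_inj val_inj.
have [s [t st]] := cone_monoid_generates R (\sum_i basis_cycle i *~ c i).
by exists s, t; rewrite /phi /= st raddfD /= coords_sum.
Qed.

Section DualCone.
Variable R : realType.
Local Notation H := (H1R G R).

Definition edge_value (e : oedge G) (x : subvs_of H) : R^o := vsval x e.

Fact edge_value_is_linear e : linear (edge_value e).
Proof. by move=> c x y; rewrite /edge_value linearP !ffunE. Qed.

HB.instance Definition _ e :=
  GRing.isLinear.Build _ _ _ _ (edge_value e) (edge_value_is_linear e).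

Lemma edge_value_sigma_dual e : sigma_dual (linfun (edge_value e)).
Proof. by move=> x /sigmaP[_ xge]; rewrite lfunE; exact: xge. Qed.

Definition real_cycle e : {ffun oedge G -> R^o} := chain_to_real R (z e).

Lemma real_cycle_H1R e : real_cycle e \in H.
Proof.
have [z0 _ _] := zA; rewrite mem_H1R; apply/eqP/ffunP=> v.
by rewrite boundary_chain_to_real z0 !ffunE.
Qed.

Lemma real_cycle_decomposition x : x \in H ->
  x = \sum_(e in A) x e *: real_cycle e.
Proof.
rewrite mem_H1R => /eqP x0; have [_ _ decomp] := zA.
apply/ffunP=> e'; rewrite decomp // sum_ffunE; apply: eq_bigr => e _.
by rewrite -[LHS](mulrzr (x e : R)) !ffunE.
Qed.

Lemma dim_H1R : \dim H = #|A|.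
Proof.
pose X := [tuple real_cycle (enum_val i) | i < #|A|].
have Xi (i : 'I_#|A|) : X`_i = real_cycle (enum_val i).
  by rewrite -tnth_nth tnth_mktuple.
suff : basis_of H X by exact: size_basis.
rewrite /basis_of eqEsubv -andbA; apply/and3P; split.
- apply/span_subvP=> _ /mapP[i _ ->]; exact: real_cycle_H1R.
- apply/subvP=> x /real_cycle_decomposition->.
  rewrite memv_suml // => e Ae.
  apply/memvZ/memv_span/mapP; exists (enum_rank_in Ae e); first exact: mem_enum.
  by rewrite enum_rankK_in.
- have [_ zz _] := zA.
  apply/freeP=> c /ffunP c0 i; have := c0 (enum_val i).
  rewrite sum_ffunE (bigD1 i) //= big1 => [|j ji].
    by rewrite Xi !ffunE zz ?enum_valP // eqxx addr0 [_ *: _]mulr1.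
  rewrite Xi !ffunE zz ?enum_valP // (inj_eq enum_val_inj) eq_sym (negPf ji).
  exact: mulr0.
Qed.

(** By the decomposition of cycles, a functional l is the combination of the
    functionals [edge_value e], for non-tree e, with coefficients its values on
    the fundamental cycles. *)
Lemma cone_dim_sigma_dual : cone_dim (@sigma_dual G R) #|A|.
Proof.
exists fullv; split.
  by rewrite dimvf -[LHS]/(dim (subvs_of H) * 1)%N muln1 -dim_H1R.
move=> W; split=> [inW|sub l _]; last exact: subvP sub l (memvf l).
apply/subvP=> l _.
pose zH e : subvs_of H := vsproj H (real_cycle e).
have -> : l = \sum_(e in A) l (zH e) *: linfun (edge_value e).
  apply/lfunP=> x; rewrite sum_lfunE.
  have {1}-> : x = \sum_(e in A) edge_value e x *: zH e.
    apply: subvs_inj.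
    rewrite linear_sum {1}(real_cycle_decomposition (subvsP x)).
    by apply: eq_bigr => e _; rewrite linearZ /= vsprojK ?real_cycle_H1R.
  rewrite linear_sum; apply: eq_bigr => e _.
  by rewrite linearZ scale_lfunE lfunE; exact: mulrC.
by apply: memv_suml => e _; apply/memvZ/inW/edge_value_sigma_dual.
Qed.

End DualCone.
End CycleCoordinates.

Theorem corollary4p2 (k : fieldType) (R : realType) (G : graph) :
  connected_graph G ->
  ~ has_torus_factor (cographic_toric G R k) /\
  exists d : nat,
    [/\ krull_dim (coord_alg (cographic_toric G R k)) d,
        cone_dim (sigma_dual (G := G) (R := R)) d,
        free_rank (H1 G) d
      & d%:Z = betti1 G + #|edges G|%:Z].
Proof.
move=> conn; split.
  exact: (@pointed_no_torus_factor k _ _ _ (@cone_monoid_pointed G R)).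
have [A [z [zA cardA]]] := cycle_basis_exists conn.
exists #|A|; split.
- exact: krull_dim_cographic zA k R.
- exact: cone_dim_sigma_dual zA R.
- exact: free_rank_H1 zA.
- by rewrite /betti1; move: cardA; rewrite card_oedge; lia.
Qed.
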